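(* None of the following varieties has the finite model property: the variety of commutative distributive $\ell$-monoids; the variety generated by the class of totally ordered monoids; the variety generated by the class of inverse-free reducts of totally ordered groups.
   Context: A distributive $\ell$-monoid is an algebraic structure $\langle M,\wedge,\vee,\cdot,\mathrm{e}\rangle$ such that $\langle M,\cdot,\mathrm{e}\rangle$ is a monoid, $\langle M,\wedge,\vee\rangle$ is a distributive lattice, and for all $a,b,c,d\in M$, $a(b\vee c)d=abd\vee acd$ and $a(b\wedge c)d=abd\wedge acd$; it is commutative if its monoid operation is commutative. An $\ell$-group is an algebraic structure $\langle L,\wedge,\vee,\cdot,{}^{-1},\mathrm{e}\rangle$ such that $\langle L,\cdot,{}^{-1},\mathrm{e}\rangle$ is a group, $\langle L,\wedge,\vee\rangle$ is a lattice, and $a\le b$ implies $cad\le cbd$ for all $a,b,c,d\in L$, where $a\le b$ means $a\wedge b=a$. A totally ordered group (respectively, totally ordered monoid) is an $\ell$-group (respectively, distributive $\ell$-monoid) whose lattice order is total. The inverse-free reduct of an $\ell$-group is its reduct to $\wedge,\vee,\cdot,\mathrm{e}$, which is a distributive $\ell$-monoid. A variety $\mathsf{V}$ has the finite model property if an equation is valid in $\mathsf{V}$ if and only if it is valid in the finite members of $\mathsf{V}$. *)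

(* Defs.v *)
From Stdlib Require List.
From mathcomp Require Import all_boot.
From mathcomp Require Import boolp classical_sets functions cardinality.

Set Implicit Arguments.
Unset Strict Implicit.
Unset Printing Implicit Defensive.

Local Open Scope classical_set_scope.

(* Algebras in the signature (meet, join, mul, e), on an arbitrary carrier.
   The structures of order.v and monoid.v are not used because the members of
   a variety have to be the models of equations in this bare signature, and
   because order.v lattices live on choice types only. *)
Record algebra := Algebra {
  carrier :> Type;
  meet : carrier -> carrier -> carrier;
  join : carrier -> carrier -> carrier;
  mul : carrier -> carrier -> carrier;
  one : carrier }.

Arguments one : clear implicits.

Inductive term :=
| Var of nat
| One
| Meet of term & term
| Join of term & term
| Mul of term & term.

Definition equation := (term * term)%type.

Fixpoint eval (A : algebra) (v : nat -> A) (t : term) : A :=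
  match t with
  | Var n => v n
  | One => one A
  | Meet s t => meet (eval v s) (eval v t)
  | Join s t => join (eval v s) (eval v t)
  | Mul s t => mul (eval v s) (eval v t)
  end.

Definition satisfies (A : algebra) (eqn : equation) : Prop :=
  forall v : nat -> A, eval v eqn.1 = eval v eqn.2.

Definition valid_in (K : set algebra) (eqn : equation) : Prop :=
  forall A, K A -> satisfies A eqn.

Definition models (E : set equation) : set algebra :=
  [set A | forall eqn, E eqn -> satisfies A eqn].

Definition is_variety (V : set algebra) : Prop :=
  exists E : set equation, V = models E.

Definition variety_generated_by (K : set algebra) : set algebra :=
  [set A | forall V, is_variety V -> K `<=` V -> V A].

Definition finite_algebra : set algebra :=
  [set A | finite_set [set: carrier A]].

Definition finite_model_property (V : set algebra) : Prop :=
  forall eqn, valid_in V eqn <-> valid_in (V `&` finite_algebra) eqn.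

Definition is_monoid (M : Type) (mul : M -> M -> M) (e : M) : Prop :=
  [/\ associative mul, left_id e mul & right_id e mul].

Definition is_lattice (M : Type) (meet join : M -> M -> M) : Prop :=
  [/\ associative meet /\ associative join,
      commutative meet /\ commutative join,
      forall a b, meet a (join a b) = a &
      forall a b, join a (meet a b) = a].

Definition is_distributive_lattice (M : Type) (meet join : M -> M -> M) : Prop :=
  is_lattice meet join /\ right_distributive meet join.

Definition lattice_le (M : Type) (meet : M -> M -> M) (a b : M) : Prop :=
  meet a b = a.

Definition lattice_total (M : Type) (meet : M -> M -> M) : Prop :=
  forall a b, lattice_le meet a b \/ lattice_le meet b a.

Definition distributive_lmonoid : set algebra :=
  [set M | [/\ is_monoid (@mul M) (one M),
               is_distributive_lattice (@meet M) (@join M),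
               forall a b c d : M,
                 mul (mul a (join b c)) d =
                 join (mul (mul a b) d) (mul (mul a c) d) &
               forall a b c d : M,
                 mul (mul a (meet b c)) d =
                 meet (mul (mul a b) d) (mul (mul a c) d)]].

Definition commutative_distributive_lmonoid : set algebra :=
  [set M | distributive_lmonoid M /\ commutative (@mul M)].

Definition totally_ordered_monoid : set algebra :=
  [set M | distributive_lmonoid M /\ lattice_total (@meet M)].

Record galgebra := GAlgebra {
  gcarrier :> Type;
  gmeet : gcarrier -> gcarrier -> gcarrier;
  gjoin : gcarrier -> gcarrier -> gcarrier;
  gmul : gcarrier -> gcarrier -> gcarrier;
  ginv : gcarrier -> gcarrier;
  gone : gcarrier }.

Arguments gone : clear implicits.

Definition is_group (G : Type) (mul : G -> G -> G) (inv : G -> G) (e : G) : Prop :=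
  [/\ is_monoid mul e, left_inverse e inv mul & right_inverse e inv mul].

Definition lgroup : set galgebra :=
  [set L | [/\ is_group (@gmul L) (@ginv L) (gone L),
               is_lattice (@gmeet L) (@gjoin L) &
               forall a b c d : L, lattice_le (@gmeet L) a b ->
                 lattice_le (@gmeet L) (gmul (gmul c a) d) (gmul (gmul c b) d)]].

Definition totally_ordered_group : set galgebra :=
  [set L | lgroup L /\ lattice_total (@gmeet L)].

Definition inverse_free_reduct (L : galgebra) : algebra :=
  Algebra (@gmeet L) (@gjoin L) (@gmul L) (gone L).

Lemma variety_generated_byP (K : set algebra) :
  is_variety (variety_generated_by K) /\ K `<=` variety_generated_by K.
Proof.
split; last by move=> A KA V _; exact.
exists (valid_in K); apply/seteqP; split => A.
- by apply; [exists (valid_in K) | move=> B KB eqn; exact].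
- move=> HA V [E ->] KV eqn Eeqn; apply: HA => B KB; exact: KV.
Qed.

Lemma commutative_distributive_lmonoid_variety :
  is_variety commutative_distributive_lmonoid.
Proof.
pose x := Var 0; pose y := Var 1; pose z := Var 2; pose w := Var 3.
pose E := [:: (Mul x (Mul y z), Mul (Mul x y) z); (Mul One x, x); (Mul x One, x);
  (Meet x (Meet y z), Meet (Meet x y) z); (Join x (Join y z), Join (Join x y) z);
  (Meet x y, Meet y x); (Join x y, Join y x);
  (Meet x (Join x y), x); (Join x (Meet x y), x);
  (Meet x (Join y z), Join (Meet x y) (Meet x z));
  (Mul (Mul x (Join y z)) w, Join (Mul (Mul x y) w) (Mul (Mul x z) w));
  (Mul (Mul x (Meet y z)) w, Meet (Mul (Mul x y) w) (Mul (Mul x z) w));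
  (Mul x y, Mul y x)].
exists (fun eqn => List.In eqn E); apply/seteqP; split => A.
- move=> [[[? ? ?] [[[? ?] [? ?] ? ?] ?] ? ?] ?] eqn /=.
  by do 13 (case=> [<- v /=|]; first by auto).
- move=> HA; pose v a b c d : nat -> A := fun n => nth d [:: a; b; c] n.
  have H n : n < 13 -> forall a b c d, eval (v a b c d) (nth (One, One) E n).1
      = eval (v a b c d) (nth (One, One) E n).2.
    move=> ltn a b c d; apply: HA => /=.
    by do 13 (case: n ltn => [|n] ltn; first by (do ?[by left | right])).
  split; first split; first split.
  + by move=> a b c; exact: (H 0 isT a b c c).
  + by move=> a; exact: (H 1 isT a a a a).
  + by move=> a; exact: (H 2 isT a a a a).
  + split; first split; first split.
    * by move=> a b c; exact: (H 3 isT a b c c).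
    * by move=> a b c; exact: (H 4 isT a b c c).
    * by split=> a b; [exact: (H 5 isT a b b b) | exact: (H 6 isT a b b b)].
    * by move=> a b; exact: (H 7 isT a b b b).
    * by move=> a b; exact: (H 8 isT a b b b).
    * by move=> a b c; exact: (H 9 isT a b c c).
  + by move=> a b c d; exact: (H 10 isT a b c d).
  + by move=> a b c d; exact: (H 11 isT a b c d).
  + by move=> a b; exact: (H 12 isT a b b b).
Qed.

(* Main.v *)
From mathcomp Require Import all_boot.
From mathcomp Require Import boolp classical_sets functions cardinality.
From mathcomp Require Import order ssralg ssrnum ssrint.
Require Import Defs.

(** The three varieties all contain the chain of integers (Z, min, max, +, 0),
    and one and the same equation separates Z from all their finite members:

      (x z y /\ w)  <=  (z \/ x w y y).

    It fails in Z at x = 3, y = -2, z = 0, w = 1. The reason for its validity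
    in a finite totally ordered monoid is that powers stabilise there: take k
    such that p = x^k and q = y^k absorb further factors x and y. If the
    equation failed, both z and x w y y would lie below both x z y and w.
    Iterating z <= x z y gives z <= p z q, iterating x w y y <= w gives
    p w q <= w, and z <= w gives p z q <= p w q, so that
      x z y <= x p z q y <= p z q <= p w q <= x p w q y y <= x w y y,
    which says that the equation does not fail after all.

    To pass from chains to arbitrary finite members, call a distributive
    l-monoid semilinear when c a d /\ u b v <= c b d \/ u a v. These algebras
    form a variety, which contains all totally ordered monoids, hence
    everything they generate, and also all commutative distributive l-monoids.
    If s is not below t in a finite semilinear algebra, then some prime filter F
    contains s and not t, and semilinearity makes the syntactic
    preorder of F (b is above a when every context that puts a into F also puts
    b into F) total. It extends the lattice order, is compatible with
    multiplication, and does not place s below t; thus the argument for chains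
    applies to it. *)

Set Implicit Arguments.
Unset Strict Implicit.
Unset Printing Implicit Defensive.

Import Order.TTheory GRing.Theory Num.Theory.

Local Open Scope classical_set_scope.

(** * Lattices presented by two operations *)

Section Lattice.
Variables (L : Type) (meet join : L -> L -> L).
Hypothesis latL : is_lattice meet join.
Local Notation "a <<= b" := (lattice_le meet a b) (at level 70).

Lemma meet_idem a : meet a a = a.
Proof. by case: latL => _ _ mK jK; rewrite -{2}(jK a a) mK. Qed.

Lemma lattice_le_refl a : a <<= a.
Proof. exact: meet_idem. Qed.

Lemma lattice_le_trans a b c : a <<= b -> b <<= c -> a <<= c.
Proof.
by case: latL => [[mA _] _ _ _]; rewrite /lattice_le => ab bc; rewrite -ab -mA bc.
Qed.

Lemma meet_lel a b : meet a b <<= a.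
Proof.
case: latL => [[mA _] [mC _] _ _].
by rewrite /lattice_le mC mA meet_idem.
Qed.

Lemma meet_ler a b : meet a b <<= b.
Proof. by case: latL => [_ [mC _] _ _]; rewrite mC; exact: meet_lel. Qed.

Lemma lattice_le_joinl a b : a <<= join a b.
Proof. by case: latL => _ _ mK _; exact: mK. Qed.

Lemma lattice_le_joinr a b : b <<= join a b.
Proof. by case: latL => [_ [_ jC] _ _]; rewrite jC; exact: lattice_le_joinl. Qed.

Lemma lattice_le_meet a b c : a <<= b -> a <<= c -> a <<= meet b c.
Proof.
by case: latL => [[mA _] _ _ _]; rewrite /lattice_le => ab ac; rewrite mA ab.
Qed.

Lemma lattice_leEjoin a b : a <<= b <-> join a b = b.
Proof.
case: latL => [_ [mC jC] mK jK]; split => [<-|<-]; last exact: mK.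
by rewrite jC mC jK.
Qed.

Lemma join_lattice_le a b c : a <<= c -> b <<= c -> join a b <<= c.
Proof.
case: latL => [[_ jA] _ _ _] /lattice_leEjoin ac /lattice_leEjoin bc.
by apply/lattice_leEjoin; rewrite -jA bc.
Qed.

End Lattice.

(** * Semilinear distributive l-monoids *)

Definition semilinear (M : algebra) : Prop :=
  forall a b c d u v : M,
    lattice_le (@meet M) (meet (mul (mul c a) d) (mul (mul u b) v))
                         (join (mul (mul c b) d) (mul (mul u a) v)).

Definition semilinear_lmonoid : set algebra :=
  [set M | distributive_lmonoid M /\ semilinear M].

Lemma dlmonoid_mul_mono (M : algebra) : distributive_lmonoid M ->
  forall a b c d : M, lattice_le (@meet M) a b ->
    lattice_le (@meet M) (mul (mul c a) d) (mul (mul c b) d).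
Proof. by move=> [_ _ _ mulM] a b c d; rewrite /lattice_le -mulM => ->. Qed.

(** All the conditions are equations; the law of semilinearity is one because
    an inequality s <= t is the equation s /\ t = s. *)
Lemma semilinear_lmonoid_variety : is_variety semilinear_lmonoid.
Proof.
pose x := Var 0; pose y := Var 1; pose z := Var 2; pose w := Var 3.
exists (valid_in semilinear_lmonoid); apply/seteqP; split => A.
  by move=> VA eqn; exact.
move=> HA.
have law (s t : term) : (forall B, semilinear_lmonoid B ->
    forall v : nat -> B, eval v s = eval v t) ->
    forall a b c d e f : A, let v := nth f [:: a; b; c; d; e] in
    eval v s = eval v t.
  by move=> st a b c d e f; apply: (HA (s, t)) => B VB v; exact: st.
split; first split.
- split=> [a b c|a|a].
  + apply: (law (Mul x (Mul y z)) (Mul (Mul x y) z) _ a b c c c c).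
    by move=> B [[[+ _ _]] *] /=; apply.
  + apply: (law (Mul One x) x _ a a a a a a).
    by move=> B [[[_ + _]] *] /=; apply.
  + apply: (law (Mul x One) x _ a a a a a a).
    by move=> B [[[_ _ +]] *] /=; apply.
- split; first split=> [||a b|a b].
  + split=> a b c.
    * apply: (law (Meet x (Meet y z)) (Meet (Meet x y) z) _ a b c c c c).
      by move=> B [[_ [[[+ _] _ _ _] _] *]] /=; apply.
    * apply: (law (Join x (Join y z)) (Join (Join x y) z) _ a b c c c c).
      by move=> B [[_ [[[_ +] _ _ _] _] *]] /=; apply.
  + split=> a b.
    * apply: (law (Meet x y) (Meet y x) _ a b b b b b).
      by move=> B [[_ [[_ [+ _] _ _] _] *]] /=; apply.
    * apply: (law (Join x y) (Join y x) _ a b b b b b).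
      by move=> B [[_ [[_ [_ +] _ _] _] *]] /=; apply.
  + apply: (law (Meet x (Join x y)) x _ a b b b b b).
    by move=> B [[_ [[_ _ + _] _] *]] /=; apply.
  + apply: (law (Join x (Meet x y)) x _ a b b b b b).
    by move=> B [[_ [[_ _ _ +] _] *]] /=; apply.
  + move=> a b c.
    apply: (law (Meet x (Join y z)) (Join (Meet x y) (Meet x z)) _ a b c c c c).
    by move=> B [[_ [_ +] *]] /=; apply.
- move=> a b c d.
  apply: (law (Mul (Mul x (Join y z)) w)
    (Join (Mul (Mul x y) w) (Mul (Mul x z) w)) _ a b c d d d).
  by move=> B [[_ _ + _] _] /= *; apply.
- move=> a b c d.
  apply: (law (Mul (Mul x (Meet y z)) w)
    (Meet (Mul (Mul x y) w) (Mul (Mul x z) w)) _ a b c d d d).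
  by move=> B [[_ _ _ +] _] /= *; apply.
- move=> a b c d u v.
  pose m := Meet (Mul (Mul z x) w) (Mul (Mul (Var 4) y) (Var 5)).
  pose j := Join (Mul (Mul z y) w) (Mul (Mul (Var 4) x) (Var 5)).
  apply: (law (Meet m j) m _ a b c d u v).
  by move=> B [_ +] val /=; apply.
Qed.

Lemma totally_ordered_monoid_semilinear :
  totally_ordered_monoid `<=` semilinear_lmonoid.
Proof.
move=> M [dM totM]; split=> // a b c d u v.
have latM : is_lattice (@meet M) (@join M) by case: dM => _ [].
have [ab|ba] := totM a b.
- apply: (lattice_le_trans latM (meet_lel latM _ _)).
  apply: (lattice_le_trans latM (dlmonoid_mul_mono dM c d ab)).
  exact: lattice_le_joinl.
- apply: (lattice_le_trans latM (meet_ler latM _ _)).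
  apply: (lattice_le_trans latM (dlmonoid_mul_mono dM u v ba)).
  exact: lattice_le_joinr.
Qed.

(** With C = c d and U = u v, semilinearity holds since
    C a /\ U b <= (C \/ U) (a /\ b) = C (a /\ b) \/ U (a /\ b) <= C b \/ U a. *)
Lemma commutative_dlmonoid_semilinear :
  commutative_distributive_lmonoid `<=` semilinear_lmonoid.
Proof.
move=> M [dM mulC]; split=> // a b c d u v.
have latM : is_lattice (@meet M) (@join M) by case: dM => _ [].
have [[mulA mul1x mulx1] _ mulJ mulM] := dM.
have mono (e f g : M) : lattice_le (@meet M) e f ->
    lattice_le (@meet M) (mul e g) (mul f g).
  by move=> ef; have := dlmonoid_mul_mono dM (one M) g ef; rewrite !mul1x.
have monor (e f g : M) : lattice_le (@meet M) e f ->
    lattice_le (@meet M) (mul g e) (mul g f).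
  by rewrite ![mul g _]mulC; exact: mono.
have swap e f g : mul (mul e f) g = mul (mul e g) f :> M.
  by rewrite -!mulA (mulC f).
rewrite [mul _ d]swap [mul _ v]swap [mul _ d in X in lattice_le _ _ X]swap.
rewrite [mul _ v in X in lattice_le _ _ X]swap.
set C := mul c d; set U := mul u v.
apply: (@lattice_le_trans _ _ _ latM _ (mul (join C U) (meet a b))).
  have := mulM (join C U) a b (one M); rewrite !mulx1 => ->.
  apply: (lattice_le_meet latM).
    apply: (lattice_le_trans latM (meet_lel latM _ _)).
    by apply: mono; exact: lattice_le_joinl.
  apply: (lattice_le_trans latM (meet_ler latM _ _)).
  by apply: mono; exact: lattice_le_joinr.
have := mulJ (one M) C U (meet a b); rewrite !mul1x => ->.
apply: (join_lattice_le latM).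
  apply: (lattice_le_trans latM _ (lattice_le_joinl latM _ _)).
  by apply: monor; exact: (meet_ler latM).
apply: (lattice_le_trans latM _ (lattice_le_joinr latM _ _)).
by apply: monor; exact: (meet_lel latM).
Qed.

(** * The separating equation in totally preordered monoids *)

Section TotallyPreorderedMonoid.
Variables (M : Type) (mul : M -> M -> M) (e : M) (le : M -> M -> Prop).
Hypothesis monM : is_monoid mul e.
Hypothesis le_refl : forall a, le a a.
Hypothesis le_trans : forall a b c, le a b -> le b c -> le a c.
Hypothesis le_total : forall a b, le a b \/ le b a.
Hypothesis le_mul : forall a b c d,
  le a b -> le (mul (mul c a) d) (mul (mul c b) d).

Definition monoid_pow (x : M) (n : nat) : M := iter n (mul x) e.

Lemma monoid_powD x m n :
  monoid_pow x (m + n) = mul (monoid_pow x m) (monoid_pow x n).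
Proof.
have [mA m1x _] := monM.
by elim: m => [|m IHm]; rewrite /= ?m1x // IHm mA.
Qed.

Lemma preord_mull a b c : le a b -> le (mul c a) (mul c b).
Proof. by have [_ _ mx1] := monM; move/(le_mul c e); rewrite !mx1. Qed.

Lemma preord_mulr a b d : le a b -> le (mul a d) (mul b d).
Proof. by have [_ m1x _] := monM; move/(le_mul e d); rewrite !m1x. Qed.

(** By totality x is above or below the unit, so that its powers are monotone
    in one direction; a repetition forces them to be constant from there on. *)
Lemma monoid_pow_stable x m n : m < n -> monoid_pow x m = monoid_pow x n ->
  forall k, m <= k ->
    le (monoid_pow x k) (monoid_pow x m) /\ le (monoid_pow x m) (monoid_pow x k).
Proof.
have [mA m1x mx1] := monM; move=> mn xmn.
suff step : le (monoid_pow x m.+1) (monoid_pow x m) /\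
            le (monoid_pow x m) (monoid_pow x m.+1).
  move=> k /subnKC <-; elim: (k - m)%N => [|d [IH1 IH2]]; first by rewrite addn0.
  rewrite addnS /=; case: step => s1 s2; split.
    exact: le_trans (preord_mull x IH1) s1.
  exact: le_trans s2 (preord_mull x IH2).
have /subnKC def_n := mn; rewrite -{}def_n in xmn.
have [ex|xe] := le_total e x.
- have up a : le a (mul x a) by have := preord_mulr a ex; rewrite m1x.
  split; last exact: up.
  rewrite xmn; elim: (_ - _)%N => [|d IH]; first by rewrite addn0.
  by apply: le_trans IH _; rewrite addnS /=; exact: up.
- have down a : le (mul x a) a by have := preord_mulr a xe; rewrite m1x.
  split; first exact: down.
  rewrite xmn; elim: (_ - _)%N => [|d IH]; first by rewrite addn0.
  by apply: le_trans IH; rewrite addnS /=; exact: down.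
Qed.

(** A failure of the separating equation in a total preorder puts z below x z y
    and w, and x w y y below w. A box x^i a y^j keeps the
    powers of x on the left and those of y on the right of a, so that boxes
    compose by adding exponents although x and y need not commute. *)
Lemma separating_le_preordered x y z w nx my nx' my' :
  nx < nx' -> monoid_pow x nx = monoid_pow x nx' ->
  my < my' -> monoid_pow y my = monoid_pow y my' ->
  le z (mul (mul x z) y) -> le z w ->
  le (mul (mul (mul x w) y) y) w ->
  le (mul (mul x z) y) (mul (mul (mul x w) y) y).
Proof.
have [mA m1x mx1] := monM.
move=> ltx eqx lty eqy z_xzy z_w xwyy_w.
have sx := monoid_pow_stable ltx eqx; have sy := monoid_pow_stable lty eqy.
(* One exponent past both repetitions, so that x^i and y^j with i, j >= k are
   equivalent to x^k and y^k. *)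
pose k := (nx + my)%N.
have pow_eqv_x i j : k <= i -> k <= j -> le (monoid_pow x i) (monoid_pow x j).
  have nxk : nx <= k by exact: leq_addr.
  move=> /(leq_trans nxk) ki /(leq_trans nxk) kj.
  exact: le_trans (proj1 (sx i ki)) (proj2 (sx j kj)).
have pow_eqv_y i j : k <= i -> k <= j -> le (monoid_pow y i) (monoid_pow y j).
  have myk : my <= k by exact: leq_addl.
  move=> /(leq_trans myk) ki /(leq_trans myk) kj.
  exact: le_trans (proj1 (sy i ki)) (proj2 (sy j kj)).
pose box a i j := mul (mul (monoid_pow x i) a) (monoid_pow y j).
have box_eqv a i j i' j' : k <= i -> k <= j -> k <= i' -> k <= j' ->
    le (box a i j) (box a i' j').
  move=> ki kj ki' kj'; apply: le_trans (preord_mulr _ (preord_mulr _ _)) _.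
    exact: (pow_eqv_x i i').
  by apply: preord_mull; exact: pow_eqv_y.
have box0 a : box a 0 0 = a by rewrite /box /= m1x mx1.
have boxD a i j i' j' : box (box a i j) i' j' = box a (i' + i) (j + j').
  by rewrite /box !monoid_powD -!mA.
have box11 a : mul (mul x a) y = box a 1 1 by rewrite /box /= !mx1.
have box12 a : mul (mul (mul x a) y) y = box a 1 2 by rewrite /box /= !mx1 -!mA.
have box_mono a b i j : le a b -> le (box a i j) (box b i j) by exact: le_mul.
rewrite box12 box11 in z_xzy xwyy_w *.
have z_box : le z (box z k k).
  elim: k {pow_eqv_x pow_eqv_y box_eqv} => [|i IH]; first by rewrite box0.
  apply: le_trans z_xzy _; apply: le_trans (box_mono _ _ 1 1 IH) _.
  by rewrite boxD add1n addn1.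
have box_w : le (box w k (k * 2)) w.
  elim: k {pow_eqv_x pow_eqv_y box_eqv z_box} => [|i IH]; first by rewrite box0.
  apply: le_trans xwyy_w; apply: le_trans (box_mono _ _ 1 2 IH).
  by rewrite boxD add1n mulSn addnC.
have boxzw : le (box z k k) (box w k k) by exact: box_mono.
apply: le_trans (box_mono _ _ 1 1 z_box) _; rewrite boxD.
apply: le_trans (box_mono _ _ 1 2 box_w); rewrite boxD.
apply: (@le_trans _ (box z k k)); first by
  apply: box_eqv; rewrite ?leq_addl ?leq_addr.
apply: le_trans boxzw _; apply: box_eqv; rewrite ?leq_addl //.
by rewrite muln2 -addnn -addnA leq_addr.
Qed.

End TotallyPreorderedMonoid.

(** * Finite semilinear algebras *)

Lemma finite_set_injection (T : Type) : finite_set [set: T] ->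
  exists n (f : T -> 'I_n), injective f.
Proof.
move=> [n]; rewrite card_eq_le => /andP[/pcard_leP[f] _].
have fn a : f a < n by have := @funS _ _ _ _ f a I.
exists n, (fun a => Ordinal (fn a)) => a b /(congr1 val) /= fab.
by apply: (@inj _ _ _ f); rewrite ?inE.
Qed.

(** A minimal element among those below s but not below t is join prime, since
    its meets with two elements that it is not below are both below t. The
    number of elements below a given one is a measure for the descent. *)
Lemma finite_join_prime_separation (L : Type) (meet join : L -> L -> L) (s t : L) :
  is_distributive_lattice meet join -> finite_set [set: L] ->
  ~ lattice_le meet s t ->
  exists j, [/\ lattice_le meet j s, ~ lattice_le meet j t &
    forall b c, lattice_le meet j (join b c) ->
      lattice_le meet j b \/ lattice_le meet j c].
Proof.
move=> [latL meetD] /finite_set_injection[n [f injf]] s_t.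
pose down a : {set 'I_n} :=
  finset (fun i => `[< exists2 b, f b = i & lattice_le meet b a >]).
pose P m := `[< exists j,
  [/\ lattice_le meet j s, ~ lattice_le meet j t & #|down j| = m] >].
have exP : exists m, P m.
  by exists #|down s|; apply/asboolP; exists s; split=> //; exact: (lattice_le_refl latL).
case: (ex_minnP exP) => m /asboolP[j [j_s j_t jm]] minm.
exists j; split=> // b c j_bc.
have meet_below a : ~ lattice_le meet j a -> lattice_le meet (meet j a) t.
  move=> j_a; have ja_j := meet_lel latL j a.
  apply: contrapT => ja_t.
  have : down (meet j a) \proper down j.
    apply/properP; split.
      apply/fintype.subsetP => i; rewrite !inE => -[d di d_ja].
      by exists d => //; exact: (lattice_le_trans latL d_ja ja_j).
    exists (f j); rewrite !inE.
      by exists j => //; exact: (lattice_le_refl latL).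
    apply/asboolP => -[d /injf-> j_ja].
    by apply: j_a; apply: (lattice_le_trans latL j_ja (meet_ler latL _ _)).
  move/proper_card; rewrite jm ltnNge => /negP; apply; apply: minm.
  apply/asboolP; exists (meet j a); split=> //.
  exact: (lattice_le_trans latL ja_j j_s).
have [j_b|/meet_below jb_t] := pselect (lattice_le meet j b); first by left.
have [j_c|/meet_below jc_t] := pselect (lattice_le meet j c); first by right.
by case: j_t; rewrite -j_bc meetD; exact: (join_lattice_le latL).
Qed.

Lemma finite_monoid_pow_repeats (M : Type) (mul : M -> M -> M) (e x : M) :
  finite_set [set: M] ->
  exists m n, m < n /\ monoid_pow mul e x m = monoid_pow mul e x n.
Proof.
move=> /finite_set_injection[n [f injf]].
pose g (i : 'I_n.+1) := f (monoid_pow mul e x i).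
have /injectivePn[i [j ij /injf gij]] : ~~ injectiveb g.
  by apply/negP => /injectiveP/leq_card; rewrite !card_ord ltnn.
have [lt_ij|lt_ji|/val_inj eq_ij] := ltngtP i j.
- by exists i, j.
- by exists j, i.
- by rewrite eq_ij eqxx in ij.
Qed.

Definition syntactic_le (M : algebra) (F : set M) (a b : M) : Prop :=
  forall c d, F (mul (mul c a) d) -> F (mul (mul c b) d).

(** Two failures of comparability would put c a d and u b v into F, but not
    c b d or u a v: a meet in F and, F being prime, a join outside F, against
    semilinearity. *)
Lemma syntactic_le_total (M : algebra) (j : M) : semilinear_lmonoid M ->
  (forall b c : M, lattice_le (@meet M) j (join b c) ->
     lattice_le (@meet M) j b \/ lattice_le (@meet M) j c) ->
  forall a b, syntactic_le (lattice_le (@meet M) j) a b \/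
              syntactic_le (lattice_le (@meet M) j) b a.
Proof.
move=> [dM semM] prime_j a b.
have latM : is_lattice (@meet M) (@join M) by case: dM => _ [].
have [ab|/existsNP[c /existsNP[d /not_implyP[cad cbd]]]] :=
  pselect (syntactic_le (lattice_le (@meet M) j) a b); first by left.
right=> u v ubv.
have j_meet := lattice_le_meet latM cad ubv.
by have [] := prime_j _ _ (lattice_le_trans latM j_meet (semM a b c d u v)).
Qed.

Definition separating_eqn : equation :=
  let: (x, y, z, w) := (Var 0, Var 1, Var 2, Var 3) in
  let s := Meet (Mul (Mul x z) y) w in
  let t := Join z (Mul (Mul (Mul x w) y) y) in
  (Meet s t, s).

Lemma finite_semilinear_satisfies_separating_eqn (M : algebra) :
  semilinear_lmonoid M -> finite_set [set: carrier M] ->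
  satisfies M separating_eqn.
Proof.
move=> semM finM v /=.
set x := v 0; set y := v 1; set z := v 2; set w := v 3.
set s := meet _ w; set t := join z _.
have [dM _] := semM; have [monM distM _ _] := dM; have [latM _] := distM.
apply: contrapT => /(finite_join_prime_separation distM finM).
move=> [j [j_s j_t prime_j]].
pose le := syntactic_le (lattice_le (@meet M) j).
have le_total := syntactic_le_total semM prime_j.
have [mA m1x mx1] := monM.
have le_refl a : le a a by [].
have le_trans a b c : le a b -> le b c -> le a c.
  by move=> ab bc d f /ab; exact: bc.
have le_mul a b c d : le a b -> le (mul (mul c a) d) (mul (mul c b) d).
  by move=> ab f g; have := ab (mul f c) (mul d g); rewrite !mA.
have le_lattice a b : lattice_le (@meet M) a b -> le a b.
  move=> ab c d; move/(lattice_le_trans latM); apply.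
  exact: dlmonoid_mul_mono.
have s_t : ~ le s t by move=> /(_ (one M) (one M)); rewrite !mx1 !m1x => /(_ j_s).
have t_s : le t s by have [] := le_total s t.
have s_xzy : le s (mul (mul x z) y) by exact/le_lattice/(meet_lel latM).
have s_w : le s w by exact/le_lattice/(meet_ler latM).
have z_s : le z s by apply: (le_trans _ _ _ _ t_s); apply/le_lattice/lattice_le_joinl.
have xwyy_t : le (mul (mul (mul x w) y) y) t.
  by apply/le_lattice/lattice_le_joinr.
have xwyy_s := le_trans _ _ _ xwyy_t t_s.
have [nx [nx' [ltx eqx]]] := finite_monoid_pow_repeats (@mul M) (one M) x finM.
have [ny [ny' [lty eqy]]] := finite_monoid_pow_repeats (@mul M) (one M) y finM.
apply: s_t; apply: (le_trans _ _ _ s_xzy); apply: (le_trans _ _ _ _ xwyy_t).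
by apply: (separating_le_preordered monM le_refl le_trans le_total le_mul
  ltx eqx lty eqy); apply: (@le_trans _ s); try exact: (@le_trans _ t).
Qed.

(** * Totally ordered groups and the integers *)

Lemma total_lattice_distributive (L : Type) (meet join : L -> L -> L) :
  is_lattice meet join -> lattice_total meet -> right_distributive meet join.
Proof.
move=> latL tot a b c; have [_ [_ jC] _ _] := latL.
wlog bc : b c / lattice_le meet b c.
  by move=> W; have [/W//|/W] := tot b c; rewrite jC => ->; rewrite jC.
have /(lattice_leEjoin latL) -> := bc.
apply/esym/(lattice_leEjoin latL)/(lattice_le_meet latL); first exact: (meet_lel latL).
exact: (lattice_le_trans latL (meet_ler latL _ _) bc).
Qed.

Lemma totally_ordered_group_reduct_monoid :
  inverse_free_reduct @` totally_ordered_group `<=` totally_ordered_monoid.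
Proof.
move=> _ [L [[[grpL _ _] latL mulL] totL] <-].
have [_ [mC jC] _ _] := latL.
split=> //; split=> //=.
- by split=> //; exact: total_lattice_distributive.
- move=> a b c d; wlog bc : b c / lattice_le (@gmeet L) b c.
    by move=> W; have [/W//|/W] := totL b c; rewrite jC => ->; rewrite jC.
  have /(lattice_leEjoin latL) -> := bc.
  by apply/esym/(lattice_leEjoin latL); exact: mulL.
- move=> a b c d; wlog bc : b c / lattice_le (@gmeet L) b c.
    by move=> W; have [/W//|/W] := totL b c; rewrite mC => ->; rewrite mC.
  by rewrite bc; apply/esym; exact: mulL.
Qed.

Definition int_group : galgebra :=
  @GAlgebra int Order.min Order.max +%R (@GRing.opp int) 0%R.

Lemma int_totally_ordered_group : totally_ordered_group int_group.
Proof.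
have leE (a b : int) : lattice_le Order.min a b <-> (a <= b)%R.
  by split=> /min_idPl.
split; first split=> /=.
- by split; [split; [exact: addrA|exact: add0r|exact: addr0]|
    exact: addNr|exact: addrN].
- split; [split; [exact: minA|exact: maxA]
         |split; [exact: minC|exact: maxC]| |] => a b.
  + exact: joinKI.
  + exact: meetKU.
- by move=> a b c d /leE ab; apply/leE; rewrite lerD2r lerD2l.
- by move=> a b; have /orP[/leE|/leE] := le_total a b; [left|right].
Qed.

(** Here x z y = w = 1 whereas z = x w y y = 0. *)
Lemma int_fails_separating_eqn :
  ~ satisfies (inverse_free_reduct int_group) separating_eqn.
Proof.
move=> /(_ (fun n => nth 0%R [:: 3%Z; (-2)%Z; 0%Z; 1%Z] n)).
by [].
Qed.

Lemma no_finite_model_property (V : set algebra) :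
  V (inverse_free_reduct int_group) ->
  V `&` finite_algebra `<=` semilinear_lmonoid ->
  ~ finite_model_property V.
Proof.
move=> Vint Vsem /(_ separating_eqn)[_ fmp].
apply: int_fails_separating_eqn; apply: fmp => // A [VA finA].
exact: finite_semilinear_satisfies_separating_eqn (Vsem A (conj VA finA)) finA.
Qed.

Theorem corollary5p9 :
  ~ finite_model_property commutative_distributive_lmonoid /\
  ~ finite_model_property (variety_generated_by totally_ordered_monoid) /\
  ~ finite_model_property
      (variety_generated_by (inverse_free_reduct @` totally_ordered_group)).
Proof.
have Zgroup : (inverse_free_reduct @` totally_ordered_group)
    (inverse_free_reduct int_group).
  by exists int_group => //; exact: int_totally_ordered_group.
have Zchain := totally_ordered_group_reduct_monoid Zgroup.
have generated (K : set algebra) : K (inverse_free_reduct int_group) ->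
    K `<=` totally_ordered_monoid ->
    ~ finite_model_property (variety_generated_by K).
  move=> KZ Kchain; apply: no_finite_model_property.
    by move=> V _; apply.
  move=> A [genA _]; apply: genA semilinear_lmonoid_variety _ => B /Kchain.
  exact: totally_ordered_monoid_semilinear.
split; last first.
  by split; apply: generated => //; exact: totally_ordered_group_reduct_monoid.
apply: no_finite_model_property => [|A [comA _]].
  by split; [case: Zchain | exact: addrC].
exact: commutative_dlmonoid_semilinear.
Qed.
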